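(* The system $\mathbf{MI_{\Box}}$ is complete with respect to $\Box$-models and with respect to descriptive $\Box$-models: if a formula $\phi$ holds at every state of every $\Box$-model (respectively, of every descriptive $\Box$-model), then $\mathbf{MI_{\Box}}\vdash\phi$.
   Context: Formulas: $\phi ::= \top\mid p\mid\phi\wedge\phi\mid\phi\to\phi\mid\Box\phi$. $\mathbf{MI_{\Box}}$ is derived by modus ponens from substitution instances of (H1) $p\to(q\to p)$, (H2) $(p\to(q\to r))\to((p\to q)\to(p\to r))$, (H3) $(p\wedge q)\to p$, (H4) $(p\wedge q)\to q$, (H5) $p\to(q\to(p\wedge q))$, (H6) $\top$, $\Box(p\wedge q)\leftrightarrow(\Box p\wedge\Box q)$, $\Box\top\leftrightarrow\top$, and closed under the rule: from $p\leftrightarrow q$ infer $\Box p\leftrightarrow\Box q$ ($\leftrightarrow$ abbreviates the conjunction of both implications). An I-frame is an implicative meet-semilattice with top viewed as a poset $(X,\leq)$. A $\Box$-frame is $(X,\leq,R)$ with $(X,\leq)$ an I-frame and (B1) $\top Rx$ iff $x=\top$, and $xR\top$ for all $x$; (B2) $xRy\leq z\Rightarrow xRz$; (B3) $xRy,x'Ry'\Rightarrow(x\wedge x')R(y\wedge y')$; (B4) $(x\wedge x')Rz\Rightarrow\exists y,y'$, $xRy$, $x'Ry'$, $y\wedge y'=z$. A $\Box$-model adds a valuation assigning a filter (non-empty up-closed set closed under finite meets) to each letter. Satisfaction: $\top$ always; $x\Vdash p$ iff $x\in V(p)$; $\wedge$ pointwise; $x\Vdash\phi\to\psi$ iff all $y\geq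 x$ with $y\Vdash\phi$ satisfy $\psi$; $x\Vdash\Box\phi$ iff all $R$-successors satisfy $\phi$. A descriptive $\Box$-frame is $(X,\leq,R,A)$ with $(X,\leq,R)$ a $\Box$-frame and $A$ a set of filters closed under $\cap$ and $a\Rightarrow b=\{x\mid\forall y\geq x,\ y\in a\Rightarrow y\in b\}$, differentiated (if $x\not\leq y$ some $a\in A$ contains $x$ not $y$), compact (covers by members of $A$ and complements have finite subcovers), closed under $p\mapsto\{x\mid R[x]\subseteq p\}$, and with $R[x]=\bigcap\{a\in A\mid R[x]\subseteq a\}$ for all $x$, where $R[x]=\{y\mid xRy\}$. A descriptive $\Box$-model is a descriptive $\Box$-frame with a valuation taking values in $A$. *)

(* Defs.v *)
From HB Require Import structures.
From mathcomp Require Import all_boot all_order.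
From mathcomp Require Import boolp classical_sets functions cardinality.

Set Implicit Arguments.
Unset Strict Implicit.
Unset Printing Implicit Defensive.

Import Order.TTheory.

Local Open Scope order_scope.
Local Open Scope classical_set_scope.

Inductive formula (P : Type) : Type :=
| Top
| Var of P
| And of formula P & formula P
| Imp of formula P & formula P
| Box of formula P.

Arguments Top {P}.

Definition Iff (P : Type) (f g : formula P) : formula P :=
  And (Imp f g) (Imp g f).

(* The axioms are schematic, so that [MIBox_axiom] holds of exactly the
   substitution instances of the listed formulas. *)
Inductive MIBox_axiom (P : Type) : formula P -> Prop :=
| H1 p q : MIBox_axiom (Imp p (Imp q p))
| H2 p q r :
    MIBox_axiom (Imp (Imp p (Imp q r)) (Imp (Imp p q) (Imp p r)))
| H3 p q : MIBox_axiom (Imp (And p q) p)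
| H4 p q : MIBox_axiom (Imp (And p q) q)
| H5 p q : MIBox_axiom (Imp p (Imp q (And p q)))
| H6 : MIBox_axiom Top
| BoxAnd p q : MIBox_axiom (Iff (Box (And p q)) (And (Box p) (Box q)))
| BoxTop : MIBox_axiom (Iff (Box Top) Top).

Inductive MIBox_derivable (P : Type) : formula P -> Prop :=
| Ax f : MIBox_axiom f -> MIBox_derivable f
| MP f g : MIBox_derivable (Imp f g) -> MIBox_derivable f -> MIBox_derivable g
| BoxCong f g : MIBox_derivable (Iff f g) ->
    MIBox_derivable (Iff (Box f) (Box g)).

(* An I-frame is an [X : tMeetSemilatticeType d] such that [implicative X]:
   each [meet a] has a right adjoint. *)
Definition implicative d (X : tMeetSemilatticeType d) : Prop :=
  forall a b : X, exists c : X, forall x : X, (x `&` a <= b)%O <-> (x <= c)%O.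

Definition meet_filter d (X : tMeetSemilatticeType d) (F : set X) : Prop :=
  [/\ F !=set0,
      forall x y : X, F x -> (x <= y)%O -> F y &
      forall x y : X, F x -> F y -> F (x `&` y)%O].

(* A relation is given by its successor sets: [R x y] is xRy and the set [R x]
   is R[x]. *)
Record box_frame d (X : tMeetSemilatticeType d) (R : X -> set X) : Prop :=
  BoxFrame {
    box_frame_implicative : implicative X;
    B1_top : forall x : X, R \top%O x <-> x = \top%O;
    B1_serial : forall x : X, R x \top%O;
    B2 : forall x y z : X, R x y -> (y <= z)%O -> R x z;
    B3 : forall x y x' y' : X, R x y -> R x' y' -> R (x `&` x')%O (y `&` y')%O;
    B4 : forall x x' z : X, R (x `&` x')%O z ->
      exists y y' : X, [/\ R x y, R x' y' & (y `&` y')%O = z]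
  }.

Fixpoint sat (P : Type) d (X : tMeetSemilatticeType d) (R : X -> set X)
    (V : P -> set X) (x : X) (f : formula P) : Prop :=
  match f with
  | Top => True
  | Var p => V p x
  | And f g => sat R V x f /\ sat R V x g
  | Imp f g => forall y : X, (x <= y)%O -> sat R V y f -> sat R V y g
  | Box f => forall y : X, R x y -> sat R V y f
  end.

Definition box_model (P : Type) d (X : tMeetSemilatticeType d) (R : X -> set X)
    (V : P -> set X) : Prop :=
  box_frame R /\ forall p : P, meet_filter (V p).

Definition imp_set d (X : tMeetSemilatticeType d) (a b : set X) : set X :=
  [set x | forall y : X, (x <= y)%O -> a y -> b y].

Definition box_set d (X : tMeetSemilatticeType d) (R : X -> set X)
  (a : set X) : set X := [set x | R x `<=` a].

Definition differentiated d (X : tMeetSemilatticeType d)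
    (A : set (set X)) : Prop :=
  forall x y : X, ~ (x <= y)%O -> exists2 a, A a & a x /\ ~ a y.

Definition cover_compact (X : Type) (A : set (set X)) : Prop :=
  forall C : set (set X), C `<=` A `|` [set ~` a | a in A] ->
    \bigcup_(c in C) c = setT ->
    exists D : set (set X),
      [/\ D `<=` C, finite_set D & \bigcup_(c in D) c = setT].

Record descriptive_box_frame d (X : tMeetSemilatticeType d) (R : X -> set X)
    (A : set (set X)) : Prop := DescriptiveBoxFrame {
  descriptive_frame : box_frame R;
  descriptive_filter : forall a, A a -> meet_filter a;
  descriptive_setI : forall a b, A a -> A b -> A (a `&` b);
  descriptive_imp : forall a b, A a -> A b -> A (imp_set a b);
  descriptive_differentiated : differentiated A;
  descriptive_compact : cover_compact A;
  descriptive_box : forall a, A a -> A (box_set R a);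
  descriptive_succ : forall x : X,
    R x = \bigcap_(a in [set a | A a /\ R x `<=` a]) a
}.

Definition descriptive_box_model (P : Type) d (X : tMeetSemilatticeType d)
    (R : X -> set X) (A : set (set X)) (V : P -> set X) : Prop :=
  descriptive_box_frame R A /\ forall p : P, A (V p).

(* Main.v *)
Require Import Defs.
From HB Require Import structures.
From mathcomp Require Import all_boot all_order.
From mathcomp Require Import boolp classical_sets functions cardinality.

(** The canonical model lives on the deductively closed sets of formulas, that
    is, on the filters of the Lindenbaum algebra, ordered by inclusion; [F]
    sees [G] when [G] contains every [f] with [Box f] in [F], and the
    admissible sets are the sets of theories containing a fixed formula.  The
    filters of an implicative meet-semilattice form a distributive lattice,
    which gives both the relative pseudocomplements of an I-frame and the
    splitting condition (B4).  Satisfaction at a theory is membership, so the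
    least theory refutes every underivable formula. *)

Set Implicit Arguments.
Unset Strict Implicit.
Unset Printing Implicit Defensive.

Local Open Scope classical_set_scope.

(** * Theories and the deduction theorem *)

Record theory (P : Type) : Type := Theory {
  formulas :> set (formula P);
  theory_derivable : forall f, MIBox_derivable f -> formulas f;
  theory_MP : forall f g, formulas (Imp f g) -> formulas f -> formulas g
}.

Arguments theory_derivable {P t f}.
Arguments theory_MP {P t f g}.

Local Identity Coercion set_Funclass : set >-> Funclass.

Section Theories.
Variable P : Type.
Implicit Types (f g h : formula P) (F G H : theory P).

Lemma theory_eq F G : F = G :> set (formula P) -> F = G.
Proof.
case: F G => [F dF mF] [G dG mG] /= eqFG.
by subst G; congr Theory; exact: Prop_irrelevance.
Qed.

Lemma theory_axiom F f : MIBox_axiom f -> F f.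
Proof. by move=> /Ax; exact: theory_derivable. Qed.

Definition theorems : theory P :=
  Theory (fun f df => df) (@MP P).

Definition adjoin F f : theory P.
Proof.
exists [set g | F (Imp f g)] => [g dg /= | g h /= Fgh Fg].
  by apply: theory_MP (theory_derivable dg); apply: theory_axiom; exact: H1.
by apply: theory_MP Fg; apply: theory_MP Fgh; apply: theory_axiom; exact: H2.
Defined.

Lemma sub_adjoin F f : F `<=` adjoin F f.
Proof. by move=> g; apply: theory_MP; apply: theory_axiom; exact: H1. Qed.

Lemma mem_adjoin F f : adjoin F f f.
Proof.
(* The goal unfolds to [F (Imp f f)], obtained as the combinator S K K. *)
have K g : F (Imp f (Imp g f)) by apply: theory_axiom; exact: H1.
apply: theory_MP (K f); apply: theory_MP (K (Imp f f)).
by apply: theory_axiom; exact: H2.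
Qed.

(** Deduction theorem: [adjoin F f] is itself an extension of [F] containing [f]. It lets later
    arguments quantify over theories in place of building Hilbert derivations. *)
Lemma theory_ImpP F f g :
  F (Imp f g) <-> forall G, F `<=` G -> G f -> G g.
Proof.
split=> [Ffg G FG Gf | FG]; first exact: theory_MP (FG _ Ffg) Gf.
exact: FG (@sub_adjoin F f) (mem_adjoin F f).
Qed.

Lemma theory_AndP F f g : F (And f g) <-> F f /\ F g.
Proof.
split=> [Ffg | [Ff Fg]].
  by split; apply: theory_MP Ffg; apply: theory_axiom; [exact: H3 | exact: H4].
by apply: theory_MP Fg; apply: theory_MP Ff; apply: theory_axiom; exact: H5.
Qed.

Lemma derivable_ImpP f g :
  MIBox_derivable (Imp f g) <-> forall F, F f -> F g.
Proof.
split=> [dfg F Ff | fg]; first exact: theory_MP (theory_derivable dfg) Ff.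
by apply/(theory_ImpP theorems) => G _; exact: fg.
Qed.

Lemma derivable_IffP f g :
  MIBox_derivable (Iff f g) <-> forall F, F f <-> F g.
Proof.
split=> [/(theory_AndP theorems)[/derivable_ImpP fg /derivable_ImpP gf] F | fg].
  by split; [exact: fg | exact: gf].
by apply/(theory_AndP theorems); split; apply/derivable_ImpP => F /fg.
Qed.

(** * The modality on theories *)

Lemma Box_AndP F f g : F (Box (And f g)) <-> F (Box f) /\ F (Box g).
Proof.
rewrite -theory_AndP; move: F; apply/derivable_IffP.
exact/Ax/BoxAnd.
Qed.

(** The calculus only has a congruence rule. If [f] entails [g], then [And f g] and [f] are
    equivalent, so [Box f] yields [Box (And f g)], over which [Box] distributes. *)
Lemma Box_mono f g : (forall F, F f -> F g) -> forall F, F (Box f) -> F (Box g).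
Proof.
move=> fg F Ff.
have /BoxCong/derivable_IffP/(_ F) : MIBox_derivable (Iff (And f g) f).
  by apply/derivable_IffP => G; rewrite theory_AndP; split=> [[]|/[dup]/fg].
by rewrite Box_AndP => -[_ /(_ Ff) []].
Qed.

Definition unbox F : theory P.
Proof.
exists [set f | F (Box f)] => [f df | f g /= Ffg Ff].
  apply: (@Box_mono Top) => [G _|]; first exact: theory_derivable.
  have /derivable_IffP/(_ F) [_] := Ax (@BoxTop P).
  by apply; apply: theory_axiom; exact: H6.
apply: (@Box_mono (And (Imp f g) f)); last exact/Box_AndP.
by move=> G /theory_AndP[]; exact: theory_MP.
Defined.

(** * Lattice operations and generated theories *)

Definition theory_meet F G : theory P.
Proof.
exists (F `&` G) => [f df | f g [Ffg Gfg] [Ff Gf]].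
  by split; exact: theory_derivable.
by split; [exact: theory_MP Ffg Ff | exact: theory_MP Gfg Gf].
Defined.

(** The least theory including both: a single premise from [F] suffices because [F] is closed under
    conjunction. *)
Definition theory_join F G : theory P.
Proof.
exists [set g | exists2 f, F f & G (Imp f g)] => [g dg | g h].
  exists Top; first by apply: theory_axiom; exact: H6.
  by apply/theory_ImpP => H _ _; exact: theory_derivable.
move=> [f Ff Gfgh] [f' Ff' Gfg]; exists (And f f'); first exact/theory_AndP.
apply/theory_ImpP => H GH /theory_AndP[Hf Hf'].
exact: theory_MP (theory_MP (GH _ Gfgh) Hf) (theory_MP (GH _ Gfg) Hf').
Defined.

Lemma sub_theory_joinl F G : F `<=` theory_join F G.
Proof. by move=> f Ff; exists f => //; apply/theory_ImpP. Qed.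

Lemma sub_theory_joinr F G : G `<=` theory_join F G.
Proof.
move=> g Gg; exists Top; first by apply: theory_axiom; exact: H6.
by apply/theory_ImpP => H GH _; exact: GH.
Qed.

(* If [f -> h] and [f' -> h] are in [H] with [f] in [F] and [f'] in [G], then
   [c -> h], where [c] is their conjunction, is in both [F] and [G]. *)
Lemma theory_joinIl F G H : F `&` G `<=` H ->
  theory_join F H `&` theory_join G H `<=` H.
Proof.
move=> FGH h [[f Ff Hfh] [f' Gf' Hf'h]].
have Hc : H (And (Imp f h) (Imp f' h)) by exact/theory_AndP.
apply: theory_MP Hc; apply: FGH; split.
  apply/theory_ImpP => K FK /theory_AndP[Kfh _]; exact: theory_MP Kfh (FK _ Ff).
apply/theory_ImpP => K GK /theory_AndP[_ Kfh]; exact: theory_MP Kfh (GK _ Gf').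
Qed.

Definition theory_total : theory P :=
  @Theory P setT (fun _ _ => I) (fun _ _ _ _ => I).

(* Closure under modus ponens: if [h] in [F] follows from [g], then [f -> h]
   follows from [f -> g], and [(f -> h) -> h] follows from [f]; both are in [F]
   because [h] is. *)
Definition theory_rpc F G : theory P.
Proof.
exists [set f | forall g, (forall H, H f -> H g) -> F g -> G g] => [f df g fg _|].
  by apply: theory_derivable; apply: (fg theorems).
move=> f g /= Gfg Gf h gh Fh.
apply: (@theory_MP _ G (Imp f h)).
  apply: Gf => [H Hf|]; apply/theory_ImpP => K HK.
    by move/theory_MP; apply; exact: HK.
  by move=> _; exact: HK.
apply: Gfg => [H Hfg|]; apply/theory_ImpP => K HK.
  by move=> Kf; apply: gh; apply: theory_MP Kf; exact: HK.
by move=> _; exact: HK.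
Defined.

Lemma theory_rpcP F G H : F `&` G `<=` H <-> F `<=` theory_rpc G H.
Proof.
split=> [FGH f Ff g fg Gg | FGH f [Ff Gf]].
  by apply: FGH; split => //; exact: fg.
exact: (FGH f Ff f).
Qed.

(** Consequence is expressed through all theories including [T], and the finiteness of [T] is built
    in for the sake of compactness. *)
Definition theory_generated (S : set (formula P)) : theory P.
Proof.
exists [set f | exists T, [/\ T `<=` S, finite_set T &
    forall F, T `<=` F -> F f]] => [f df | f g].
  exists set0; split; first exact: sub0set.
    exact: finite_set0.
  by move=> F _; exact: theory_derivable.
move=> [T [TS finT Tfg]] [U [US finU Uf]]; exists (T `|` U); split.
- by rewrite subUset.
- by rewrite finite_setU.
- by move=> F; rewrite subUset => -[/Tfg Ffg /Uf]; exact: theory_MP.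
Defined.

Lemma sub_theory_generated (S : set (formula P)) : S `<=` theory_generated S.
Proof.
move=> f Sf; exists [set f]; split => [g -> //||F]; first exact: finite_set1.
exact.
Qed.

Definition theory_le : rel (theory P) := fun F G => `[< F `<=` G >].

Lemma theory_le_refl : reflexive theory_le.
Proof. by move=> F; apply/asboolP. Qed.

Lemma theory_le_anti : antisymmetric theory_le.
Proof.
move=> F G /andP[/asboolP FG /asboolP GF]; apply: theory_eq.
by rewrite eqEsubset.
Qed.

Lemma theory_le_trans : transitive theory_le.
Proof.
by move=> G F H /asboolP FG /asboolP GH; apply/asboolP; exact: subset_trans GH.
Qed.

Lemma theory_le_meet F G H :
  theory_le F (theory_meet G H) = theory_le F G && theory_le F H.
Proof.
by rewrite /theory_le -asbool_and; congr asbool; exact: subsetI.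
Qed.

Lemma theory_le_total F : theory_le F theory_total.
Proof. exact/asboolP. Qed.

HB.instance Definition _ := gen_eqMixin (theory P).
HB.instance Definition _ := gen_choiceMixin (theory P).
HB.instance Definition _ := Order.Le_isPOrder.Build (Order.Disp tt tt) (theory P)
  theory_le_refl theory_le_anti theory_le_trans.
HB.instance Definition _ := Order.POrder_isMeetSemilattice.Build
  (Order.Disp tt tt) (theory P) theory_le_meet.
HB.instance Definition _ := Order.hasTop.Build (Order.Disp tt tt) (theory P)
  theory_le_total.

Lemma theory_leP F G : (F <= G)%O <-> F `<=` G.
Proof. by split=> [/asboolP|FG] //; exact/asboolP. Qed.

(** * The canonical frame and model *)

Definition canonical_rel F : set (theory P) := [set G | unbox F `<=` G].

Definition canonical_set f : set (theory P) := [set F | F f].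

Lemma theory_Imp_leP F f g :
  F (Imp f g) <-> forall G, (F <= G)%O -> G f -> G g.
Proof.
rewrite theory_ImpP.
by split=> FG G; [move/theory_leP | move=> FleG]; apply: FG => //; exact/theory_leP.
Qed.

(** Conversely, [unbox F] is the least successor of [F], so testing [f] there is enough. *)
Lemma theory_BoxP F f : F (Box f) <-> canonical_rel F `<=` canonical_set f.
Proof.
split=> [Ff G FG | FG]; first exact: FG.
exact: (FG (unbox F)).
Qed.

Lemma canonical_box_frame : box_frame canonical_rel.
Proof.
split.
- move=> F G; exists (theory_rpc F G) => H.
  rewrite !theory_leP; exact: theory_rpcP.
- move=> F; split=> [tF | -> //].
  by apply: theory_eq; rewrite predeqE => f; split=> // _; exact: tF.
- by [].
- by move=> F G H FG /theory_leP; exact: subset_trans.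
- by move=> F G F' G' FG FG' f [Ff F'f]; split; [exact: FG | exact: FG'].
- move=> F F' H FH.
  (* For (B4), [FH] says that the meet of [unbox F] and [unbox F'] lies below [H]; by
     distributivity, joining each with [H] gives two theories whose meet is exactly [H]. *)
  exists (theory_join (unbox F) H), (theory_join (unbox F') H).
  split; try exact: sub_theory_joinl.
  apply: theory_eq; rewrite eqEsubset; split; first exact: theory_joinIl.
  by move=> f Hf; split; exact: sub_theory_joinr.
Qed.

Lemma canonical_set_filter f : meet_filter (canonical_set f).
Proof.
split; first by exists theory_total.
  by move=> F G Ff /theory_leP; exact.
by move=> F G.
Qed.

Lemma canonical_compact : cover_compact (range canonical_set).
Proof.
move=> C CA covC.
(* The theory generated by [S] avoids every complement in [C], so a positive member
   [canonical_set f] covers it. Then [f] follows from a finite [T] included in [S], and any theory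
   either includes [T], hence contains [f], or omits some [g] in [T]. *)
pose S := [set f | C (~` canonical_set f)].
have [c Cc cS] : (\bigcup_(c in C) c) (theory_generated S) by rewrite covC.
have [[f _ eqc] | [a [f _ <-] eqc]] := CA c Cc; subst c; last first.
  by case: cS; exact: sub_theory_generated.
have [T [TS finT Tf]] := cS.
exists (canonical_set f |` [set ~` canonical_set g | g in T]); split.
- by move=> _ [-> // | [g Tg <-]]; exact: TS.
- by rewrite finite_setU; split; [exact: finite_set1 | exact: finite_image].
rewrite -subTset => F _.
have [TF | /existsNP[g /not_implyP[Tg nFg]]] := pselect (T `<=` F).
  by exists (canonical_set f); [left | exact: Tf].
by exists (~` canonical_set g) => //; right; exists g.
Qed.

Lemma canonical_descriptive_frame :
  descriptive_box_frame canonical_rel (range canonical_set).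
Proof.
split.
- exact: canonical_box_frame.
- by move=> _ [f _ <-]; exact: canonical_set_filter.
- move=> _ _ [f _ <-] [g _ <-]; exists (And f g) => //.
  by rewrite predeqE => F; exact: theory_AndP.
- move=> _ _ [f _ <-] [g _ <-]; exists (Imp f g) => //.
  by rewrite predeqE => F; exact: theory_Imp_leP.
- move=> F G /theory_leP/existsNP[f /not_implyP[Ff nGf]].
  by exists (canonical_set f) => //; exists f.
- exact: canonical_compact.
- move=> _ [f _ <-]; exists (Box f) => //.
  by rewrite predeqE => F; exact: theory_BoxP.
(* If [Box f] is in [F], then [canonical_set f] is one of the intersected sets, so every [G] in the
   intersection contains [f]. *)
- move=> F; rewrite eqEsubset; split=> [G FG a [_]|G FG f Ff]; first exact.
  by apply: (FG (canonical_set f)); split; [exists f | exact/theory_BoxP].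
Qed.

Lemma canonical_satP F f :
  sat canonical_rel (canonical_set \o @Var P) F f <-> F f.
Proof.
elim: f F => [|p|f IHf g IHg|f IHf g IHg|f IHf] F //=.
- by split=> // _; apply: theory_axiom; exact: H6.
- by rewrite theory_AndP IHf IHg.
- rewrite theory_Imp_leP.
  by split=> FG G FleG /IHf /(FG G FleG) /IHg.
- rewrite theory_BoxP; split=> FG G /FG; by move/IHf.
Qed.

End Theories.

Theorem theorem5p9 (P : Type) (phi : formula P) :
  ((forall (d : Order.disp_t) (X : tMeetSemilatticeType d) (R : X -> set X)
      (V : P -> set X),
      box_model R V -> forall x : X, sat R V x phi) ->
    MIBox_derivable phi) /\
  ((forall (d : Order.disp_t) (X : tMeetSemilatticeType d) (R : X -> set X)
      (A : set (set X)) (V : P -> set X),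
      descriptive_box_model R A V -> forall x : X, sat R V x phi) ->
    MIBox_derivable phi).
Proof.
split=> valid; apply/(canonical_satP (theorems P)).
  apply: valid; split; first exact: canonical_box_frame.
  by move=> p; exact: canonical_set_filter.
apply: (valid _ _ _ (range (@canonical_set P))).
by split=> [|p]; [exact: canonical_descriptive_frame | exists (Var p)].
Qed.
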